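(* For all integers $n\geq 0$ we have $$\sum_{k=0}^\infty\frac{\binom{2k}{k}}{4^k(2k+n+1)} =\begin{cases} \binom{n}{n/2}\dfrac{\pi}{2^{n+1}} & \text{if $n$ is even},\\[2mm] \dfrac{2^{n-1}}{n\binom{n-1}{(n-1)/2}} & \text{if $n$ is odd}. \end{cases}$$ More concisely, for all integers $n\geq 0$ we have $$\sum_{k=0}^\infty\frac{\binom{2k}{k}}{4^k(2k+n+1)}=\binom{n}{n/2}\frac{\pi}{2^{n+1}},$$ where $\binom{n}{n/2}$ is considered a generalized binomial coefficient in the case of odd $n$.
   Context: The generalized binomial coefficient is $\binom{n}{n/2}=\dfrac{\Gamma(n+1)}{\Gamma(\frac n2+1)^2}$, where $\Gamma$ is the gamma function. *)

(* Defs.v *)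
From HB Require Import structures.
From mathcomp Require Import all_boot all_order all_algebra.
From mathcomp Require Import all_classical all_reals all_analysis.

Set Implicit Arguments.
Unset Strict Implicit.
Unset Printing Implicit Defensive.

Import Order.TTheory GRing.Theory Num.Theory.
Import numFieldNormedType.Exports.

Local Open Scope classical_set_scope.
Local Open Scope ring_scope.

(* Meaningful for [0 < x], where the integral is finite; for [x <= 0] the
   integral is infinite and [Rintegral] returns [0]. *)
Definition Gamma (R : realType) (x : R) : R :=
  \int[lebesgue_measure]_(t in `]0%R, +oo[) (t `^ (x - 1) * expR (- t)).

(* The generalized binomial coefficient "n choose n/2", with [n / 2] the exact
   (possibly half-integral) quotient. *)
Definition gbinom_half (R : realType) (n : nat) : R :=
  Gamma (n%:R + 1) / Gamma (n%:R / 2 + 1) ^+ 2.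

(* Main.v *)
Require Import Defs.
From HB Require Import structures.
From mathcomp Require Import all_boot all_order all_algebra.
From mathcomp Require Import all_classical all_reals all_analysis.
From mathcomp Require Import measurable_realfun.
From mathcomp Require Import ring lra zify.

Set Implicit Arguments.
Unset Strict Implicit.
Unset Printing Implicit Defensive.

Import Order.TTheory GRing.Theory Num.Theory.
Import numFieldNormedType.Exports.

Local Open Scope classical_set_scope.
Local Open Scope ring_scope.

(* Write c_k = 'C(2k, k) / 4^k and a_n for the sum of the series. Telescoping
   2k c_k / (2k + n + 1) gives (n + 2) a_(n+2) = (n + 1) a_n, and telescoping
   c_k gives a_1 = 1. On the other side put I_n = \int_0^oo u^n exp(- u^2) du.
   Integration by parts gives I_(n+2) = (n + 1) / 2 I_n and t = u^2 gives
   Gamma (n / 2 + 1) = 2 I_(n+1). By Cauchy-Schwarz (I_n) is log-convex, so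
   b_n = (sqrt pi / 2) I_n / I_(n+1) is nonincreasing; it satisfies the same
   recurrence as a_n and b_1 = 1. A positive nonincreasing solution of this
   recurrence is determined by its value at 1, since squeezing f(2m) between
   f(2m - 1) and f(2m + 1) determines f(0). Hence a = b, which yields
   a_0 = pi / 2 through the Gaussian integral. *)

(** * Half-line integrals as limits over the segments from 0 to m *)

Section gauss_moments.
Context {R : realType}.
Let mu := @lebesgue_measure R.

Lemma integrable_segment (f : R -> R) (a b : R) : continuous f ->
  mu.-integrable `[a, b] (EFin \o f).
Proof.
move=> cf; apply: continuous_compact_integrable; first exact: segment_compact.
exact: continuous_subspaceT.
Qed.

Lemma cvg_integral0y (f : R -> R) : continuous f ->
  (forall x, 0 <= x -> 0 <= f x) ->
  (\int[mu]_(x in `[0%R, m%:R]) f x)%:E @[m --> \oo] -->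
  (\int[mu]_(x in `[0%R, +oo[) (f x)%:E)%E.
Proof.
move=> cf f0.
have fin m : (\int[mu]_(x in `[0%R, m%:R]) f x)%:E =
    (\int[mu]_(x in `[0%R, m%:R]) (f x)%:E)%E.
  by rewrite /Rintegral fineK//; apply: integrable_fin_num => //;
    exact: integrable_segment.
under eq_cvg do rewrite fin.
(* The monotone limit is applied to the absolute value, which is nonnegative on the whole line and
   agrees with [f] on the half-line. *)
have mf : measurable_fun setT (fun x => `|f x|).
  by apply: measurableT_comp => //; exact: continuous_measurable_fun.
have := @ge0_cvgn_integral R mu (fun x => `|f x|) (fun=> normr_ge0 _) mf.
have E (b : itv_bound R) : (\int[mu]_(x in [set` Interval (BLeft 0%R) b]) `|f x|%:E
  = \int[mu]_(x in [set` Interval (BLeft 0%R) b]) (f x)%:E)%E.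
  apply: eq_integral => x; rewrite inE/= => /andP[x0 _].
  by rewrite ger0_norm// f0.
by rewrite E; under eq_cvg do rewrite E.
Qed.

(** The equation lives in the extended reals, so that it also records finiteness. *)
Lemma integral0y_eq (f : R -> R) (l : R) : continuous f ->
  (forall x, 0 <= x -> 0 <= f x) ->
  \int[mu]_(x in `[0, m%:R]) f x @[m --> \oo] --> l ->
  (\int[mu]_(x in `[0%R, +oo[) (f x)%:E)%E = l%:E.
Proof.
move=> cf f0 fl; apply: (cvg_unique _ (cvg_integral0y cf f0)) => //.
by apply: cvg_EFin; [exact: nearW|].
Qed.

Lemma cvg_integral0y_fin (f : R -> R) (l : R) : continuous f ->
  (forall x, 0 <= x -> 0 <= f x) ->
  (\int[mu]_(x in `[0%R, +oo[) (f x)%:E)%E = l%:E ->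
  \int[mu]_(x in `[0, m%:R]) f x @[m --> \oo] --> l.
Proof.
move=> cf f0 fl; have := cvg_integral0y cf f0; rewrite fl.
by move=> /fine_cvgP[].
Qed.

(** * The integrands u^n exp(- u^2): derivative and decay *)

Definition gauss_monom n (u : R) := u ^+ n * gauss_fun u.

Lemma continuous_gauss_monom n : continuous (gauss_monom n).
Proof.
by move=> x; apply: cvgM; [exact: exprn_continuous|exact: continuous_gauss_fun].
Qed.

Lemma gauss_monom_ge0 n x : 0 <= x -> 0 <= gauss_monom n x.
Proof. by move=> x0; rewrite mulr_ge0 ?exprn_ge0 ?gauss_fun_ge0. Qed.

Lemma is_derive_gauss (x : R) : is_derive x 1 gauss_fun (- (2 * gauss_monom 1 x)).
Proof.
apply: is_derive_eq.
by rewrite /gauss_monom /gauss_fun -[x%:A]/(x * 1); ring.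
Qed.

Lemma is_derive_gauss_monom n (x : R) :
  is_derive x 1 (gauss_monom n.+1) (n.+1%:R * gauss_monom n x - 2 * gauss_monom n.+2 x).
Proof.
have dX : is_derive x 1 (fun y : R => y ^+ n.+1) (n.+1%:R * x ^+ n).
  apply: DeriveDef; first exact: exprn_derivable.
  by rewrite exp_derive -[LHS]/(_ * _ * 1) mulr1.
have H := is_deriveM dX (is_derive_gauss x).
apply: is_derive_eq.
rewrite -[LHS]/(x ^+ n.+1 * - (2 * gauss_monom 1 x) + gauss_fun x * (n.+1%:R * x ^+ n)).
by rewrite /gauss_monom !exprS; ring.
Qed.

(** From exp(y) >= y^(n+1) / (n+1)! at y = (m+1)^2, the value at m + 1 is at most (n+1)! / (m+1). *)
Lemma cvg_gauss_monom n : gauss_monom n m%:R @[m --> \oo] --> (0 : R).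
Proof.
rewrite -cvg_shiftS/=.
apply: (@squeeze_cvgr _ _ _ _ (fun=> 0) (fun m => (n.+1`!)%:R * harmonic m)); last 2 first.
- exact: cvg_cst.
- by rewrite -[X in _ --> X](mulr0 n.+1`!%:R); apply: cvgMl_tmp; exact: cvg_harmonic.
apply: nearW => m; rewrite gauss_monom_ge0//= /gauss_monom /gauss_fun expRN /harmonic.
rewrite ler_pdivrMr ?expR_gt0// mulrAC ler_pdivlMr ?ltr0n// -exprSr.
have := @expR_ge1Dxn R (m.+1%:R ^+ 2) n (sqr_ge0 _).
move=> /(le_trans _) H.
rewrite -ler_pdivrMl ?ltr0n ?fact_gt0// mulrC; apply: H.
rewrite ler_wpDl// ler_pM2r ?invr_gt0 ?ltr0n ?fact_gt0//.
by rewrite -exprM ler_weXn2l ?ler1n// leq_pmull.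
Qed.

Lemma integral_deriv (F f : R -> R) (a b : R) : a < b -> continuous f ->
  (forall x : R, is_derive x (1 : R) F (f x)) ->
  \int[mu]_(x in `[a, b]) f x = F b - F a.
Proof.
move=> ab cf dF.
have cF : continuous F.
  by move=> x; apply/differentiable_continuous/derivable1_diffP; case: (dF x).
rewrite /Rintegral (@continuous_FTC2 _ f F)//.
- exact: continuous_subspaceT.
- split.
  + by move=> x _; case: (dF x).
  + by apply: cvg_at_right_filter; exact: cF.
  + by apply: cvg_at_left_filter; exact: cF.
- by move=> x _; rewrite derive1E; case: (dF x).
Qed.

(** * Truncated moments, taken up to m + 1 so that the segment is never degenerate, and their
    limits *)

Definition trunc_moment n (m : nat) : R := \int[mu]_(x in `[0, m.+1%:R]) gauss_monom n x.

Lemma trunc_moment1 m : trunc_moment 1 m = (1 - gauss_fun m.+1%:R) / 2.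
Proof.
have c : continuous (fun x : R => - (2 * gauss_monom 1 x)).
  by move=> x; apply: cvgN; apply: cvgMl_tmp; exact: continuous_gauss_monom.
have := integral_deriv (ltr0Sn R m) c is_derive_gauss.
under eq_Rintegral do rewrite -mulNr.
rewrite RintegralZl//; last by apply: integrable_segment; exact: continuous_gauss_monom.
rewrite -/(trunc_moment 1 m) {2}/gauss_fun expr0n/= oppr0 expR0.
lra.
Qed.

(** Integration by parts, done by integrating the derivative of [gauss_monom n.+1], whose value at 0
    vanishes. *)
Lemma trunc_momentSS n m :
  trunc_moment n.+2 m = (n.+1%:R * trunc_moment n m - gauss_monom n.+1 m.+1%:R) / 2.
Proof.
have c k (a : R) : continuous (fun x : R => a * gauss_monom k x).
  by move=> x; apply: cvgMl_tmp; exact: continuous_gauss_monom.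
have c' : continuous (fun x : R => n.+1%:R * gauss_monom n x - 2 * gauss_monom n.+2 x).
  by move=> x; apply: cvgB; exact: c.
have := integral_deriv (ltr0Sn R m) c' (is_derive_gauss_monom n).
rewrite RintegralB//; [|exact: integrable_segment..].
rewrite !RintegralZl//; [|apply: integrable_segment; exact: continuous_gauss_monom..].
rewrite -/(trunc_moment n m) -/(trunc_moment n.+2 m) [gauss_monom n.+1 0]/gauss_monom expr0n/= mul0r.
lra.
Qed.

Definition gauss_moment n : R := \int[mu]_(x in `[0, +oo[) gauss_monom n x.

Lemma gauss_moment_fin n (l : R) : trunc_moment n m @[m --> \oo] --> l ->
  (\int[mu]_(x in `[0%R, +oo[) (gauss_monom n x)%:E)%E = l%:E.
Proof.
move=> H; apply: integral0y_eq; [exact: continuous_gauss_monom|exact: gauss_monom_ge0|].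
by rewrite -cvg_shiftS.
Qed.

Lemma cvg_trunc_moment0 : trunc_moment 0 m @[m --> \oo] --> (Num.sqrt pi / 2 : R).
Proof.
rewrite (cvg_shiftS (fun m => \int[mu]_(x in `[0, m%:R]) gauss_monom 0 x)).
apply: cvg_integral0y_fin; [exact: continuous_gauss_monom|exact: gauss_monom_ge0|].
by rewrite -integral0y_gauss; apply: eq_integral => x _; rewrite /gauss_monom mul1r.
Qed.

Lemma cvg_trunc_moment1 : trunc_moment 1 m @[m --> \oo] --> (2^-1 : R).
Proof.
under eq_cvg do rewrite trunc_moment1.
suff : (1 - gauss_fun m.+1%:R) / 2 @[m --> \oo] --> ((1 - 0) / 2 : R).
  by rewrite subr0 div1r.
apply: cvgMr_tmp; apply: cvgB; first exact: cvg_cst.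
rewrite (cvg_shiftS (fun m => gauss_fun m%:R)).
rewrite (_ : (fun m => _) = (fun m => gauss_monom 0 m%:R)); first exact: cvg_gauss_monom.
by apply/funext => m; rewrite /gauss_monom mul1r.
Qed.

Lemma cvg_trunc_momentSS n (l : R) : trunc_moment n m @[m --> \oo] --> l ->
  trunc_moment n.+2 m @[m --> \oo] --> n.+1%:R / 2 * l.
Proof.
move=> H; under eq_cvg do rewrite trunc_momentSS.
rewrite (_ : _ / 2 * l = (n.+1%:R * l - 0) / 2); last by rewrite subr0 mulrAC.
apply: cvgMr_tmp; apply: cvgB; first exact: cvgMl_tmp.
by rewrite (cvg_shiftS (fun m => gauss_monom n.+1 m%:R)); exact: cvg_gauss_monom.
Qed.

Lemma cvg_trunc_moment n : exists2 l : R, 0 < l & trunc_moment n m @[m --> \oo] --> l.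
Proof.
(* The recurrence has step two, so the induction carries two consecutive indices. *)
suff [] : (exists2 l : R, 0 < l & trunc_moment n m @[m --> \oo] --> l) /\
  (exists2 l : R, 0 < l & trunc_moment n.+1 m @[m --> \oo] --> l) by [].
elim: n => [|n [[l l0 Hl] H1]]; split => //.
- by exists (Num.sqrt pi / 2); [rewrite divr_gt0 ?sqrtr_gt0 ?pi_gt0|exact: cvg_trunc_moment0].
- by exists 2^-1; [rewrite invr_gt0|exact: cvg_trunc_moment1].
- exists (n.+1%:R / 2 * l); last exact: cvg_trunc_momentSS.
  by rewrite mulr_gt0// divr_gt0.
Qed.

Lemma gauss_momentP n : trunc_moment n m @[m --> \oo] --> gauss_moment n.
Proof.
have [l _ H] := cvg_trunc_moment n.
by rewrite /gauss_moment /Rintegral (gauss_moment_fin H).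
Qed.

Lemma gauss_moment_gt0 n : 0 < gauss_moment n.
Proof.
have [l l0 H] := cvg_trunc_moment n.
by rewrite /gauss_moment /Rintegral (gauss_moment_fin H).
Qed.

Lemma gauss_momentE n (l : R) : trunc_moment n m @[m --> \oo] --> l -> gauss_moment n = l.
Proof. by move=> H; rewrite /gauss_moment /Rintegral (gauss_moment_fin H). Qed.

Lemma gauss_momentSS n : gauss_moment n.+2 = n.+1%:R / 2 * gauss_moment n.
Proof. exact/gauss_momentE/cvg_trunc_momentSS/gauss_momentP. Qed.

(** Cauchy-Schwarz by the discriminant: the integral of u^n (a - u)^2 exp(- u^2) is a quadratic in a
    that is never negative. It is expanded on segments and then passed to the limit. *)
Lemma gauss_moment_logconvex n : gauss_moment n.+1 ^+ 2 <= gauss_moment n * gauss_moment n.+2.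
Proof.
have H (a : R) m : 0 <= a ^+ 2 * trunc_moment n m -
    2 * a * trunc_moment n.+1 m + trunc_moment n.+2 m.
  have c k (b : R) : mu.-integrable `[0, m.+1%:R] (EFin \o (fun x : R => b * gauss_monom k x)).
    by apply: integrable_segment => x; apply: cvgMl_tmp; exact: continuous_gauss_monom.
  have c1 k : mu.-integrable `[0, m.+1%:R] (EFin \o @gauss_monom k).
    by apply: integrable_segment; exact: continuous_gauss_monom.
  rewrite /trunc_moment -!RintegralZl// -RintegralB// -RintegralD//; last first.
    apply: integrable_segment => x; apply: cvgB; apply: cvgMl_tmp; exact: continuous_gauss_monom.
  apply: Rintegral_ge0 => x /=; rewrite in_itv/= => /andP[x0 _].
  rewrite (_ : _ + _ = gauss_monom n x * (a - x) ^+ 2); last by rewrite /gauss_monom !exprS; ring.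
  by rewrite mulr_ge0 ?gauss_monom_ge0// sqr_ge0.
have {}H (a : R) : 0 <= a ^+ 2 * gauss_moment n - 2 * a * gauss_moment n.+1 + gauss_moment n.+2.
  have E : a ^+ 2 * trunc_moment n m - 2 * a * trunc_moment n.+1 m +
      trunc_moment n.+2 m @[m --> \oo] -->
      a ^+ 2 * gauss_moment n - 2 * a * gauss_moment n.+1 + gauss_moment n.+2.
    apply: cvgD; last exact: gauss_momentP.
    by apply: cvgB; apply: cvgMl_tmp; exact: gauss_momentP.
  rewrite -(cvg_lim _ E)//; apply: limr_ge; last exact: nearW.
  by apply/cvg_ex; eexists; exact: E.
have p0 := gauss_moment_gt0 n.
(* This choice of a minimises the quadratic. *)
have := H (gauss_moment n.+1 / gauss_moment n).
rewrite -(pmulr_rge0 _ p0) [X in 0 <= X](_ : _ =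
  gauss_moment n * gauss_moment n.+2 - gauss_moment n.+1 ^+ 2).
  by rewrite subr_ge0.
by field; rewrite gt_eqF.
Qed.

(** Under t = u^2, t^(n/2) exp(- t) dt becomes 2 u^(n+1) exp(- u^2) du. The substitution is made on
    segments, followed by a limit. *)
Lemma Gamma_half n : Gamma (n%:R / 2 + 1 : R) = 2 * gauss_moment n.+1.
Proof.
(* [sqrt t ^+ n] equals [t `^ (n / 2)] for [t > 0] and is continuous everywhere. *)
pose G (t : R) := Num.sqrt t ^+ n * expR (- t).
have cG : continuous G.
  move=> x; apply: cvgM.
    by apply: (@continuous_comp _ _ _ (@Num.sqrt R) (fun y => y ^+ n));
      [exact: sqrt_continuous|exact: exprn_continuous].
  by apply: (@continuous_comp _ _ _ -%R (@expR R));
    [exact: oppr_continuous|exact: continuous_expR].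
have G0 x : 0 <= x -> 0 <= G x by rewrite mulr_ge0 ?exprn_ge0 ?sqrtr_ge0 ?expR_ge0.
have dE : derive1 (fun x : R => x ^+ 2) = (fun x : R => 2 * x).
  by apply/funext => x; rewrite exp_derive1 expr1.
have cd : continuous (derive1 (fun x : R => x ^+ 2)).
  by rewrite dE => x; apply: cvgMl_tmp; exact: cvg_id.
have cs : continuous (fun x : R => x ^+ 2) by exact: exprn_continuous.
have sub m : \int[mu]_(x in `[0, (m.+1 ^ 2)%:R]) G x = 2 * trunc_moment n.+1 m.
  rewrite /trunc_moment -RintegralZl//; last first.
    by apply: integrable_segment; exact: continuous_gauss_monom.
  congr fine; have := @integration_by_substitution_increasing R (fun x => x ^+ 2) G 0 m.+1%:R.
  rewrite expr0n/= -natrX => ->//.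
  - by apply: eq_integral => x; rewrite inE/= in_itv/= => /andP[x0 _]; congr EFin;
      rewrite -[LHS]/(G (x ^+ 2) * derive1 (fun x : R => x ^+ 2) x) dE;
      rewrite /G sqrtr_sqr ger0_norm// /gauss_monom /gauss_fun [x ^+ n.+1]exprS; ring.
  - by move=> x y; rewrite !in_itv/= => /andP[x0 _] /andP[y0 _] xy; rewrite ltrXn2r.
  - by apply/cvg_ex; exists (derive1 (fun x : R => x ^+ 2) 0);
      apply: cvg_at_right_filter; exact: cd.
  - by apply/cvg_ex; exists (derive1 (fun x : R => x ^+ 2) m.+1%:R);
      apply: cvg_at_left_filter; exact: cd.
  - split.
    + by move=> x _; exact: exprn_derivable.
    + by apply: cvg_at_right_filter; exact: cs.
    + by apply: cvg_at_left_filter; exact: cs.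
  - exact: continuous_subspaceT.
(* The substituted segments end at squares, so the limit is taken along that subsequence. *)
have sq : (m.+1 ^ 2)%N @[m --> \oo] --> \oo.
  move=> A [N _ NA]; exists N => // m /= Nm; apply: NA => /=.
  by rewrite (leq_trans Nm)// (leq_trans (leqnSn m))// -mulnn leq_pmulr.
have iG : (\int[mu]_(x in `[0%R, +oo[) (G x)%:E)%E = (2 * gauss_moment n.+1)%:E.
  have := cvg_comp _ _ sq (cvg_integral0y cG G0).
  rewrite /comp; under eq_cvg do rewrite sub.
  move=> H; apply: (cvg_unique _ H) => //.
  by apply: cvg_EFin; [exact: nearW|apply: cvgMl_tmp; exact: gauss_momentP].
rewrite /Gamma /Rintegral.
have -> : (\int[mu]_(x in `]0%R, +oo[) (x `^ (n%:R / 2 + 1 - 1) * expR (- x))%:E =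
    \int[mu]_(x in `]0%R, +oo[) (G x)%:E)%E.
  apply: eq_integral => x; rewrite inE/= in_itv/= andbT => x0; congr EFin.
  by rewrite addrK [n%:R / 2]mulrC powRrM powR12_sqrt ?ltW// powR_mulrn ?sqrtr_ge0 ?ltW.
rewrite integral_itv_obnd_cbnd ?iG//.
by apply/measurable_EFinP; apply: measurable_funTS; exact: continuous_measurable_fun.
Qed.

End gauss_moments.

(** * Normalised central binomial coefficients: ratio and decay *)

Section central_binomial_series.
Context {R : realType}.

Definition cbin (k : nat) : R := 'C(2 * k, k)%:R / 4 ^+ k.

(** Two absorption identities, passing through the coefficient 2k+1 over k. *)
Lemma mul_central_bin k : (k.+1 * 'C(2 * k.+1, k.+1) = 2 * (2 * k).+1 * 'C(2 * k, k))%N.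
Proof.
have D := mul_bin_diag (2 * k.+1) k.
have := mul_bin_down (2 * k).+1 k.
rewrite (_ : ((2 * k).+1 - k = k.+1)%N) /=; last by lia.
rewrite -D mulnS /= add1n => H.
by rewrite -[in RHS]mulnA H; lia.
Qed.

Lemma cbinS k : cbin k.+1 = cbin k * ((2 * k + 1)%:R / (2 * k + 2)%:R).
Proof.
have := congr1 (fun n => n%:R : R) (mul_central_bin k).
rewrite /cbin exprS !natrM.
have : k.+1%:R != 0 :> R by rewrite pnatr_eq0.
have : 4 ^+ k != 0 :> R by rewrite expf_neq0.
move: ('C(_, _)%:R) => x; move: ('C(_, _)%:R) => y; move: (4 ^+ k) => z z0 k0 H.
rewrite -natr1 in k0 *.
rewrite ![(2 * k + _)%:R]natrD [(2 * k)%:R]natrM.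
rewrite -[k.+1%:R]natr1 -[(2 * k).+1%:R]natr1 natrM in H.
have -> : x = 2 * (2 * k%:R + 1) * y / (k%:R + 1) by rewrite -H mulrAC divff// mul1r.
by field; rewrite z0 k0 /= (_ : 2 * k%:R + 2 = 2 * (k%:R + 1)) ?mulf_neq0//; ring.
Qed.

Lemma cbin_gt0 k : 0 < cbin k.
Proof. by rewrite divr_gt0 ?exprn_gt0// ltr0n bin_gt0 leq_pmull. Qed.

Lemma cbin_ge0 k : 0 <= cbin k.
Proof. exact/ltW/cbin_gt0. Qed.

(** The left side starts at 1 and is multiplied at each step by (2k+1)(2k+3) / (2k+2)^2 <= 1. This
    yields the decay of [cbin]. *)
Lemma cbin_sqr_le k : cbin k ^+ 2 * (2 * k + 1)%:R <= 1.
Proof.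
elim: k => [|k IH].
  by rewrite /cbin bin0 expr0 divr1 expr1n mul1r.
apply: le_trans IH; rewrite cbinS exprMn -mulrA ler_wpM2l ?sqr_ge0//.
rewrite expr_div_n mulrAC ler_pdivrMr ?exprn_gt0 ?ltr0n ?addn_gt0 ?orbT//.
rewrite expr2 -mulrA ler_wpM2l// -!natrX -!natrM ler_nat; lia.
Qed.

Lemma cvg_cbin : cbin m @[m --> \oo] --> (0 : R).
Proof.
apply: (@squeeze_cvgr _ _ _ _ (fun=> 0) (fun m => Num.sqrt (harmonic m))); last 2 first.
- exact: cvg_cst.
- by rewrite -[X in _ --> X]sqrtr0; apply: continuous_cvg; [exact: sqrt_continuous|exact: cvg_harmonic].
apply: nearW => m; rewrite cbin_ge0//=.
rewrite -[cbin m]ger0_norm ?cbin_ge0// -sqrtr_sqr ler_sqrt ?harmonic_ge0//.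
rewrite /harmonic -[leRHS]mul1r ler_pdivlMr ?ltr0n//.
apply: le_trans (cbin_sqr_le m); rewrite ler_wpM2l ?sqr_ge0// ler_nat; lia.
Qed.

(** * Partial sums over k < m: telescoping and convergence *)

Definition bseries n : R^nat := series (fun k => cbin k / (2 * k + n + 1)%:R).

(** By the ratio of [cbin], the k-th summand on the left is the increment of 2k c_k / (2k+n+1) from
    k to k + 1. *)
Lemma bseriesSS n m : n.+1%:R * bseries n m - n.+2%:R * bseries n.+2 m =
  cbin m * ((2 * m)%:R / (2 * m + n + 1)%:R).
Proof.
elim: m => [|m IH]; first by rewrite /bseries !seriesEnat/= !big_geq// muln0 !mul0r !mulr0 subrr.
rewrite /bseries !seriesEnat/= !big_nat_recr//=.
move: IH; rewrite /bseries !seriesEnat/= => IH.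
rewrite !mulrDr opprD addrACA IH cbinS.
have e1 : (2 * m + n + 1)%:R != 0 :> R by rewrite pnatr_eq0 addn1.
have e2 : (2 * m + 2)%:R != 0 :> R by rewrite pnatr_eq0 addn2.
have e3 : (2 * m + n + 3)%:R != 0 :> R by rewrite pnatr_eq0 addn3.
rewrite (_ : (2 * m + n.+2 + 1 = 2 * m + n + 3)%N); last by lia.
rewrite (_ : (2 * m.+1 + n + 1 = 2 * m + n + 3)%N); last by lia.
rewrite (_ : (2 * m.+1 = 2 * m + 2)%N); last by lia.
rewrite -[n.+1%:R]natr1 -[n.+2%:R]natr1 -[n.+1%:R]natr1.
move: e1 e2 e3; move: (2 * m)%N => a; rewrite !natrD => e1 e2 e3.
by field; rewrite e1 e2 e3.
Qed.

(** Telescoping, since c_k / (2k+2) = c_k - c_(k+1). *)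
Lemma bseries1 m : bseries 1 m = 1 - cbin m.
Proof.
elim: m => [|m IH]; first by rewrite /bseries seriesEnat/= big_geq// /cbin bin0 expr0 divr1 subrr.
rewrite /bseries seriesEnat/= big_nat_recr//=.
move: IH; rewrite /bseries seriesEnat/= => ->.
rewrite cbinS -addnA.
have e2 : (2 * m + 2)%:R != 0 :> R by rewrite pnatr_eq0 addn2.
by move: e2; move: (2 * m)%N => a; rewrite !natrD => e2; field.
Qed.

Lemma bseries_le n m : bseries n.+1 m <= bseries n m.
Proof.
rewrite /bseries !seriesEnat/=; apply: ler_sum => k _.
by rewrite ler_wpM2l ?cbin_ge0// lef_pV2 ?posrE ?ltr0n ?addn1// ler_nat; lia.
Qed.

Lemma cvg_bseriesSS n (l : R) : bseries n m @[m --> \oo] --> l ->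
  bseries n.+2 m @[m --> \oo] --> n.+1%:R / n.+2%:R * l.
Proof.
move=> H.
(* The boundary term of the telescoping lies between 0 and c_m. *)
have H0 : cbin m * ((2 * m)%:R / (2 * m + n + 1)%:R) @[m --> \oo] --> (0 : R).
  apply: (@squeeze_cvgr _ _ _ _ (fun=> 0) cbin); last 2 first.
  - exact: cvg_cst.
  - exact: cvg_cbin.
  apply: nearW => m; rewrite mulr_ge0 ?divr_ge0 ?cbin_ge0//=.
  rewrite ler_piMr ?cbin_ge0// ler_pdivrMr ?ltr0n ?addn1// mul1r ler_nat; lia.
have E m : bseries n.+2 m =
  (n.+1%:R * bseries n m - cbin m * ((2 * m)%:R / (2 * m + n + 1)%:R)) / n.+2%:R.
  by rewrite -bseriesSS opprB addrC subrK mulrAC divff ?mul1r// pnatr_eq0.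
under eq_cvg do rewrite E.
rewrite (_ : _ * l = (n.+1%:R * l - 0) / n.+2%:R); last by rewrite subr0 mulrAC.
by apply: cvgMr_tmp; apply: cvgB => //; exact: cvgMl_tmp.
Qed.

Lemma cvg_bseries1 : bseries 1 m @[m --> \oo] --> (1 : R).
Proof.
under eq_cvg do rewrite bseries1.
suff : 1 - cbin m @[m --> \oo] --> (1 - 0 : R) by rewrite subr0.
by apply: cvgB; [exact: cvg_cst|exact: cvg_cbin].
Qed.

(** Comparison with index 1: 1 / (2k+1) <= 2 / (2k+2) bounds the increasing partial sums by 2. *)
Lemma is_cvg_bseries0 : cvgn (bseries 0).
Proof.
apply: nondecreasing_is_cvgn.
  apply/nondecreasing_seqP => m; rewrite /bseries !seriesEnat/= big_nat_recr//=.
  by rewrite lerDl divr_ge0 ?cbin_ge0.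
exists 2 => _ [m _ <-].
apply: (@le_trans _ _ (2 * bseries 1 m)).
  rewrite /bseries !seriesEnat/= mulr_sumr; apply: ler_sum => k _.
  rewrite mulrCA ler_wpM2l ?cbin_ge0// ler_pdivlMr ?ltr0n ?addn1//.
  rewrite mulrC ler_pdivrMr ?ltr0n ?addn1// -natrM ler_nat; lia.
by rewrite bseries1 -[leRHS]mulr1 ler_pM2l// gerBl cbin_ge0.
Qed.

Lemma is_cvg_bseries n : cvgn (bseries n).
Proof.
suff [] : cvgn (bseries n) /\ cvgn (bseries n.+1) by [].
elim: n => [|n [H H1]]; split => //; first exact: is_cvg_bseries0.
  by apply/cvg_ex; exists 1; exact: cvg_bseries1.
by apply/cvg_ex; eexists; exact: (cvg_bseriesSS H).
Qed.

(** * Uniqueness for a monotone two-step recurrence *)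

(* [f 0 / g 0] equals [f (2 m) / g (2 m)], while [f] and [g] agree at odd
   indices; monotonicity pins both even terms to their odd neighbours. *)
Lemma le_wallis_recurrence (f g : nat -> R) :
  (forall n, 0 < g n) -> (forall n, f n.+1 <= f n) -> (forall n, g n.+1 <= g n) ->
  (forall n, f n.+2 = n.+1%:R / n.+2%:R * f n) ->
  (forall n, g n.+2 = n.+1%:R / n.+2%:R * g n) -> f 1%N = g 1%N -> g 0%N <= f 0%N.
Proof.
move=> g_gt0 df dg rf rg fg1.
have c0 m : f (2 * m)%N * g 0%N = f 0%N * g (2 * m)%N.
  elim: m => [|m IH]; first by rewrite mulrC.
  by rewrite mulnS add2n rf rg -[LHS]mulrA IH mulrCA.
have c1 m : f (2 * m).+1 = g (2 * m).+1.
  by elim: m => // m IH; rewrite mulnS add2n rf rg IH.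
(* The chain g(2m+2) <= g(2m+1) = f(2m+1) <= f(2m) gives (1 - 1/(2m+2)) g(2m) <= f(2m). The factor
   is weakened to 1 - 1/(m+1), and the constant ratio carries the bound to index 0. *)
have H m : g 0%N * (1 - harmonic m) <= f 0%N.
  have := le_trans (dg (2 * m).+1) (le_trans _ (df (2 * m)%N)).
  rewrite c1 rg => /(_ (lexx _)) H.
  rewrite -(ler_pM2r (g_gt0 (2 * m)%N)) -c0 -mulrA mulrC ler_pM2r//.
  apply: le_trans H; rewrite ler_pM2r// lerBlDr.
  rewrite /harmonic/= -[m.+1%:R^-1]div1r -subr_ge0.
  rewrite (_ : _ - 1 = (2 * m.+1%:R)^-1) ?invr_ge0//.
  have k0 : m%:R + 1 != 0 :> R by rewrite natr1 pnatr_eq0.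
  rewrite (_ : ((2 * m).+2 = 2 * m.+1)%N); last by lia.
  rewrite natrM -[(2 * m).+1%:R]natr1 natrM -[m.+1%:R]natr1.
  by move: (m%:R) k0 => x k0; field.
have E : g 0%N * (1 - harmonic m) @[m --> \oo] --> g 0%N * (1 - 0).
  by apply: cvgMl_tmp; apply: cvgB; [exact: cvg_cst|exact: cvg_harmonic].
rewrite -[leLHS]mulr1 -[1]subr0 -(cvg_lim _ E)//; apply: limr_le.
  by apply/cvg_ex; eexists; exact: E.
exact: nearW.
Qed.

Lemma wallis_recurrence_unique (f g : nat -> R) :
  (forall n, 0 < f n) -> (forall n, 0 < g n) ->
  (forall n, f n.+1 <= f n) -> (forall n, g n.+1 <= g n) ->
  (forall n, f n.+2 = n.+1%:R / n.+2%:R * f n) ->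
  (forall n, g n.+2 = n.+1%:R / n.+2%:R * g n) -> f 1%N = g 1%N -> f =1 g.
Proof.
move=> f0 g0 df dg rf rg fg1.
(* The one-sided bound is used twice, with [f] and [g] exchanged. *)
have fg0 : f 0%N = g 0%N by apply/eqP; rewrite eq_le !le_wallis_recurrence.
move=> n; suff [] : f n = g n /\ f n.+1 = g n.+1 by [].
by elim: n => // n [H H1]; split => //; rewrite rf rg H.
Qed.

(** * Sums of the series *)

Definition bsum n : R := limn (bseries n).

Lemma bsum1 : bsum 1 = 1.
Proof. exact: cvg_lim cvg_bseries1. Qed.

Lemma bsumSS n : bsum n.+2 = n.+1%:R / n.+2%:R * bsum n.
Proof. by apply: cvg_lim => //; exact/cvg_bseriesSS/is_cvg_bseries. Qed.

Lemma bsum_le n : bsum n.+1 <= bsum n.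
Proof.
apply: ler_lim; [exact: is_cvg_bseries..|].
by apply: nearW => m; exact: bseries_le.
Qed.

Lemma bsum_gt0 n : 0 < bsum n.
Proof.
suff [] : 0 < bsum n /\ 0 < bsum n.+1 by [].
elim: n => [|n [H H1]]; split => //.
- by apply: lt_le_trans (bsum_le 0); rewrite bsum1.
- by rewrite bsum1.
- by rewrite bsumSS mulr_gt0// divr_gt0.
Qed.

End central_binomial_series.

(** * Sums as moment ratios, and the closed forms *)

Lemma gauss_moment0 (R : realType) : gauss_moment 0 = Num.sqrt pi / 2 :> R.
Proof. exact/gauss_momentE/cvg_trunc_moment0. Qed.

Lemma gauss_moment1 (R : realType) : gauss_moment 1 = 2^-1 :> R.
Proof. exact/gauss_momentE/cvg_trunc_moment1. Qed.

(** The factor sqrt(pi) / 2 normalises the right side to 1 at n = 1; log-convexity makes it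
    nonincreasing. *)
Lemma bsum_gauss_moment (R : realType) n :
  bsum n = Num.sqrt pi / 2 * (gauss_moment n / gauss_moment n.+1) :> R.
Proof.
have m0 k := gt_eqF (@gauss_moment_gt0 R k).
apply: (@wallis_recurrence_unique R bsum
  (fun n => Num.sqrt pi / 2 * (gauss_moment n / gauss_moment n.+1))) => {n}.
- exact: bsum_gt0.
- move=> n; rewrite mulr_gt0 ?divr_gt0 ?gauss_moment_gt0//.
  by rewrite sqrtr_gt0 pi_gt0.
- exact: bsum_le.
- move=> n; rewrite ler_wpM2l ?divr_ge0 ?sqrtr_ge0//.
  rewrite ler_pdivrMr ?gauss_moment_gt0// mulrAC ler_pdivlMr ?gauss_moment_gt0// -expr2.
  exact: gauss_moment_logconvex.
- exact: bsumSS.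
- move=> n; rewrite !gauss_momentSS.
  have : n.+2%:R != 0 :> R by rewrite pnatr_eq0.
  move: (m0 n.+1) (n.+1%:R) (n.+2%:R) => /negbT m1 a b b0.
  by field; rewrite m1 b0.
- rewrite bsum1 gauss_momentSS gauss_moment0 gauss_moment1; field.
  by rewrite gt_eqF// sqrtr_gt0 pi_gt0.
Qed.

Lemma bsum0 (R : realType) : bsum 0 = pi / 2 :> R.
Proof.
rewrite bsum_gauss_moment gauss_moment0 gauss_moment1.
rewrite -[in RHS](sqr_sqrtr (pi_ge0 R)); by field.
Qed.

Lemma gbinom_half_gauss_moment (R : realType) n :
  gbinom_half R n = gauss_moment (2 * n).+1 / (2 * gauss_moment n.+1 ^+ 2).
Proof.
(* The numerator is read as Gamma((2n)/2 + 1), so [Gamma_half] covers it too. *)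
rewrite /gbinom_half Gamma_half (_ : n%:R = (2 * n)%:R / 2) ?Gamma_half.
  by field; rewrite gt_eqF// gauss_moment_gt0.
by rewrite natrM mulrAC divff ?mul1r.
Qed.

Lemma bsum_gbinom_half (R : realType) n :
  bsum n = gbinom_half R n * (pi / 2 ^+ n.+1).
Proof.
have m0 k := gt_eqF (@gauss_moment_gt0 R k).
have p0 := gt_eqF (pi_gt0 R).
suff [] : bsum n = gbinom_half R n * (pi / 2 ^+ n.+1) /\
  bsum n.+1 = gbinom_half R n.+1 * (pi / 2 ^+ n.+2) by [].
elim: n => [|n [H H1]]; split => //.
- by rewrite bsum0 gbinom_half_gauss_moment muln0 gauss_moment1 expr1; field.
- rewrite bsum1 gbinom_half_gauss_moment -[(2 * 1)%N]/2%N !gauss_momentSS gauss_moment1 gauss_moment0.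
  rewrite !exprMn exprVn sqr_sqrtr ?pi_ge0//.
  by move: pi p0 => p /negbT p1; field; rewrite p1.
(* From n to n + 2 the generalized binomial is multiplied by 4(n+1)/(n+2); the 4 is absorbed by the
   power of 2. *)
- rewrite bsumSS H !gbinom_half_gauss_moment !mulnS !add2n !gauss_momentSS.
  rewrite (exprS 2 n.+2) (exprS 2 n.+1).
  have -> : (2 * n).+4%:R = 2 * n.+2%:R :> R by rewrite -natrM; congr _%:R; lia.
  have -> : (2 * n).+2%:R = 2 * n.+1%:R :> R by rewrite -natrM; congr _%:R; lia.
  have n1 : n.+1%:R != 0 :> R by rewrite pnatr_eq0.
  have n2 : n.+2%:R != 0 :> R by rewrite pnatr_eq0.
  move: (m0 n.+1) n1 n2 => /negbT m1.
  move: (n.+1%:R) (n.+2%:R) => a b a0 b0.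
  by field; rewrite b0 m1 expf_neq0.
Qed.

(** The step-two factors (2k+1)/(2k+2) and (2k+2)/(2k+3) of the sums are the ratios of c_k and of
    1/((2k+1) c_k). *)
Lemma bsum_cbin (R : realType) k :
  bsum (2 * k) = cbin k * (pi / 2) :> R /\
  bsum (2 * k).+1 = ((2 * k).+1%:R * cbin k)^-1 :> R.
Proof.
elim: k => [|k [IH IH1]].
  by rewrite bsum0 bsum1 /cbin bin0 expr0 divr1 !mul1r invr1.
rewrite mulnS add2n !bsumSS IH IH1 cbinS addn1 addn2.
have c0 : cbin k != 0 :> R by rewrite gt_eqF// cbin_gt0.
have n1 : (2 * k).+1%:R != 0 :> R by rewrite pnatr_eq0.
have n2 : (2 * k).+2%:R != 0 :> R by rewrite pnatr_eq0.
have n3 : (2 * k).+3%:R != 0 :> R by rewrite pnatr_eq0.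
move: ((2 * k).+1%:R) ((2 * k).+2%:R) ((2 * k).+3%:R) n1 n2 n3 => a b c a0 b0 d0.
by split; field; rewrite ?c0 ?a0 ?b0 ?d0.
Qed.

Theorem corollary3p3 (R : realType) (n : nat) :
  let S : R^nat :=
    series (fun k : nat => 'C(2 * k, k)%:R / (4 ^+ k * (2 * k + n + 1)%:R)) in
  (S m @[m --> \oo] -->
     if odd n then 2 ^+ n.-1 / (n%:R * 'C(n.-1, n.-1./2)%:R)
     else 'C(n, n./2)%:R * (pi / 2 ^+ n.+1)) /\
  (S m @[m --> \oo] --> gbinom_half R n * (pi / 2 ^+ n.+1)).
Proof.
move=> S.
have SE : S = bseries n.
  by rewrite /S /bseries; congr series; apply/funext => k; rewrite /cbin invfM mulrA.
(* Both proposed limits equal [bsum n], evaluated once by parity and once through Gamma. *)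
have -> : (if odd n then 2 ^+ n.-1 / (n%:R * 'C(n.-1, n.-1./2)%:R)
    else 'C(n, n./2)%:R * (pi / 2 ^+ n.+1)) = gbinom_half R n * (pi / 2 ^+ n.+1).
  rewrite -bsum_gbinom_half -[n in RHS]odd_double_half.
  have [E0 E1] := bsum_cbin R n./2.
  have e4 : 2 ^+ (2 * n./2) = 4 ^+ n./2 :> R by rewrite exprM -natrX.
  case: ifPn => [on|en].
    have nE : n = (2 * n./2).+1 by rewrite mul2n -[LHS]odd_double_half on.
    rewrite add1n -mul2n E1 {1 2 3 4}nE /= mul2n half_double -mul2n e4 /cbin.
    by rewrite !invfM invrK mulrC [RHS]mulrA.
  have nE : n = (2 * n./2)%N by rewrite mul2n -[LHS]odd_double_half (negbTE en).
  rewrite add0n -mul2n E0 {1 3}nE exprS e4 /cbin.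
  by field; rewrite expf_neq0.
(* What remains is convergence of the partial sums to their own [limn], which is what [cvgn]
   states. *)
by rewrite SE -bsum_gbinom_half; split; exact: is_cvg_bseries.
Qed.
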